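(* The following statements are equivalent (all spaces considered being regular): (1) $\omega_1=\mathfrak d$; (2) every regular strongly star Menger space $X$ satisfies $e(X)\leq\omega$; (3) for regular spaces of cardinality less than $\mathfrak d$, being set strongly star Menger and being strongly star Menger are equivalent; (4) for regular spaces of cardinality less than $\mathfrak d$, being set strongly star Lindelöf and being strongly star Lindelöf are equivalent; (5) every closed subspace of a regular strongly star Menger space $X$ with $|X|<\mathfrak d$ is strongly star Menger.
   Context: For a family $\mathcal U$ of subsets of $X$ and $A\subseteq X$, $st(A,\mathcal U)=\bigcup\{U\in\mathcal U: U\cap A\neq\emptyset\}$. $X$ is strongly star Lindelöf if for every open cover $\mathcal U$ there is a countable $C\subseteq X$ with $st(C,\mathcal U)=X$; strongly star Menger if for every sequence $(\mathcal U_n)$ of open covers there are finite $F_n\subseteq X$ with $X=\bigcup_n st(F_n,\mathcal U_n)$. $X$ is set strongly star Lindelöf if for every nonempty $A\subseteq X$ and every family $\mathcal U$ of open sets with $\overline A\subseteq\bigcup\mathcal U$ there is a countable $F\subseteq\overline A$ with $A\subseteq st(F,\mathcal U)$; set strongly star Menger if for every nonempty $A$ and every sequence $(\mathcal U_n)$ of families of open sets with $\overline A\subseteq\bigcup\mathcal U_n$ for all $n$ there are finite $F_n\subseteq\overline A$ with $A\subseteq\bigcup_n st(F_n,\mathcal U_n)$. $e(X)$ is the supremum of cardinalities of closed discrete subsets. $\mathfrak d$ is the minimal cardinality of a cofinal subset of $(\omega^\omega,\leq^* )$. *)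

(* Defs.v *)
From HB Require Import structures.
From mathcomp Require Import all_boot all_order all_algebra.
From mathcomp Require Import all_classical all_reals all_analysis.

Set Implicit Arguments.
Unset Strict Implicit.
Unset Printing Implicit Defensive.

Local Open Scope classical_set_scope.

(* Regular space: T1 + points and closed sets separated (Engelking). *)
Definition regular (X : topologicalType) : Prop :=
  accessible_space X /\ @regular_space X.

Definition star (X : Type) (A : set X) (U : set (set X)) : set X :=
  \bigcup_(V in [set V | U V /\ V `&` A !=set0]) V.

Definition open_family (X : topologicalType) (U : set (set X)) : Prop :=
  forall V, U V -> open V.

Definition open_cover (X : topologicalType) (U : set (set X)) : Prop :=
  open_family U /\ \bigcup_(V in U) V = setT.

Definition strongly_star_Lindelof (X : topologicalType) : Prop :=
  forall U : set (set X), open_cover U ->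
    exists C : set X, countable C /\ star C U = setT.

Definition strongly_star_Menger (X : topologicalType) : Prop :=
  forall U : nat -> set (set X), (forall n, open_cover (U n)) ->
    exists F : nat -> set X, (forall n, finite_set (F n)) /\
      \bigcup_n star (F n) (U n) = setT.

Definition set_strongly_star_Lindelof (X : topologicalType) : Prop :=
  forall (A : set X) (U : set (set X)), A !=set0 ->
    open_family U -> closure A `<=` \bigcup_(V in U) V ->
    exists F : set X, [/\ countable F, F `<=` closure A & A `<=` star F U].

Definition set_strongly_star_Menger (X : topologicalType) : Prop :=
  forall (A : set X) (U : nat -> set (set X)), A !=set0 ->
    (forall n, open_family (U n)) ->
    (forall n, closure A `<=` \bigcup_(V in U n) V) ->
    exists F : nat -> set X, [/\ forall n, finite_set (F n),
      forall n, F n `<=` closure A &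
      A `<=` \bigcup_n star (F n) (U n)].

Definition discrete_subset (X : topologicalType) (A : set X) : Prop :=
  forall a, A a -> exists2 W : set X, open W & W `&` A = [set a].

Definition extent_countable (X : topologicalType) : Prop :=
  forall A : set X, closed A -> discrete_subset A -> countable A.

Definition le_star (f g : nat -> nat) : Prop :=
  exists m, forall n, (m <= n)%N -> (f n <= g n)%N.

Definition dominating (D : set (nat -> nat)) : Prop :=
  forall f, exists2 g, D g & le_star f g.

(* |T| < d : no family of size <= |T| is dominating (d is the minimum). *)
Definition card_lt_dd (T : Type) : Prop :=
  forall h : T -> (nat -> nat), ~ dominating (range h).

Definition omega1_order (I : Type) (lt : I -> I -> Prop) : Prop :=
  (forall x, ~ lt x x) /\
  (forall x y z, lt x y -> lt y z -> lt x z) /\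
  (forall x y, lt x y \/ x = y \/ lt y x) /\
  well_founded lt /\
  ~ countable [set: I] /\
  (forall x, countable [set y | lt y x]).

(* omega_1 = d :  d > omega (no countable family is dominating) and
   d <= omega_1 (some family indexed by a copy of omega_1 is dominating). *)
Definition omega1_eq_dd : Prop :=
  (forall h : nat -> (nat -> nat), ~ dominating (range h)) /\
  exists (I : Type) (lt : I -> I -> Prop),
    omega1_order lt /\ exists h : I -> (nat -> nat), dominating (range h).

(* Main.v *)
(* If [omega1 = d], spaces of size less than [d] are countable, and countable
   spaces trivially have all the star properties.  For the extent, let
   [(x_b)_b] be a closed discrete [omega1]-sequence in a regular space and [G_b]
   a neighbourhood of [x_b] whose closure misses the other [x_a].  As
   [d = omega1], there are finite sets [A_n(b)] of indices below [b] such that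
   every sequence [(S_n)_n] of finite sets of indices satisfies, for some [b],
   [S_n `<=` A_n(b)] for almost all [n].  Shrink [G_b] at stage [n] by removing
   the closures of the [G_a] with [a] in [A_n(b)]: given finite sets [F_n], pick
   for each point of [F_n] one index whose shrunk neighbourhood contains it, and
   let [S_n] consist of these indices; then the [b] above has, for almost all
   [n], a shrunk neighbourhood that misses [F_n].

   If [omega1 < d], the Mrowka space of [omega1] branches of the binary tree is
   a regular strongly star Menger space of size [omega1], and its branches form
   an uncountable closed discrete set. *)
Require Import Defs.
From mathcomp Require Import all_boot all_order all_algebra.
From mathcomp Require Import all_classical all_reals all_analysis.
From mathcomp Require Import wochoice.
From HB Require Import structures.

Local Open Scope classical_set_scope.

(** * Countable sets, finite sets and the inequality omega < d *)

Lemma countable_image {T U : Type} (f : T -> U) (A : set T) :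
  countable A -> countable (f @` A).
Proof. exact/sub_countable/card_image_le. Qed.

Lemma countable_inj_image {T U : Type} (f : T -> U) (A : set T) :
  injective f -> countable (f @` A) -> countable A.
Proof.
move=> f_inj /countable_injP[g g_inj]; apply/countable_injP; exists (g \o f).
move=> x y; rewrite !inE => Ax Ay /g_inj xy.
by apply: f_inj; apply: xy; rewrite inE; [exists x|exists y].
Qed.

Lemma uncountable_cantor : ~ countable [set: nat -> bool].
Proof.
move=> /countable_injP[f f_inj].
(* As [f] is injective, [g (f b)] is the negation of [b (f b)] for every [b]; the contradiction
   comes from [b := g]. *)
pose g n := ~~ `[< exists2 b, f b = n & b n >].
suff : g (f g) = ~~ g (f g) by case: (g (f g)).
congr (~~ _); apply/asboolP/idP => [[b /f_inj -> //]|]; rewrite ?inE//.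
by move=> gfg; exists g.
Qed.

Lemma countable_not_dominating (h : nat -> nat -> nat) : ~ dominating (range h).
Proof.
(* This function exceeds [h k] at every [n >= k]. *)
move=> /(_ (fun n => (\max_(k < n.+1) h k n).+1))[_ [k _ <-]] [m le_m].
have := le_m (maxn m k) (leq_maxl _ _); apply/negP; rewrite -ltnNge ltnS.
have ltk : (k < (maxn m k).+1)%N by rewrite ltnS leq_maxr.
exact: (leq_bigmax (Ordinal ltk) (F := fun i : 'I__ => h i (maxn m k))).
Qed.

Lemma finite_set_nat_bounded {T : Type} (f : T -> nat) (A : set T) :
  finite_set A -> exists n, forall x, A x -> (f x <= n)%N.
Proof.
move=> /(finite_image f)/finite_seqP[s fA].
exists (\max_(i <- s) i)%N => x Ax.
have fxs : f x \in s by have : (f @` A) (f x) by [exists x]; rewrite fA.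
exact: (leq_bigmax_seq (F := id)).
Qed.

Lemma finite_set_bounded_inj {T : Type} (f : T -> nat) (A : set T) n :
  {in A &, injective f} -> (forall x, A x -> (f x <= n)%N) -> finite_set A.
Proof.
move=> f_inj f_le; rewrite -(eq_finite_set (inj_card_eq f_inj)).
by apply: (sub_finite_set _ (finite_II n.+1)) => _ [x /f_le ? <-] /=.
Qed.

(** * Orders of type omega_1 *)

Lemma omega1_bounded {I : Type} {lt : I -> I -> Prop} (S : set I) :
  omega1_order lt -> countable S -> exists d, forall s, S s -> lt s d.
Proof.
move=> [_ [_ [lt_total [_ [uncI cnt_lt]]]]] cntS; apply: contrapT => unbounded.
apply: uncI.
(* If nothing bounds [S], every point is at most some [s] in [S], and [I] is a countable union of
   countable segments. *)
have -> : [set: I] = \bigcup_(s in S) ([set y | lt y s] `|` [set s]).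
  apply/seteqP; split=> // y _; apply: contrapT => ny; apply: unbounded.
  exists y => s Ss; have [//|[sy|ys]] := lt_total s y; exfalso; apply: ny;
    by exists s; [|right + left].
apply: bigcup_countable => // s _.
rewrite -bigcup2E; apply: bigcup_countable => // -[|[|n]] _ //=.
Qed.

(** Transfinite recursion: at [x], pick a point of [D] outside the set of values taken below [x],
    which is countable while [D] is not. *)
Lemma omega1_embeds {I : Type} {lt : I -> I -> Prop} {T : Type} (D : set T) :
  omega1_order lt -> ~ countable D ->
  exists2 i : I -> T, injective i & forall x, D (i x).
Proof.
move=> [lt_irr [_ [lt_total [lt_wf [_ cnt_lt]]]]] uncD.
have fresh (S : set T) : countable S -> D `\` S !=set0.
  move=> cntS; apply: contrapT => /set0P/negP/negPn/eqP; rewrite setD_eq0 => DS.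
  exact/uncD/(sub_countable (subset_card_le DS)).
have [t0 _] := fresh set0 (countable0 _).
have [pick pickP] : {pick : set T -> T & forall S, S !=set0 -> S (pick S)}.
  apply: (@choice _ _ (fun S t => S !=set0 -> S t)) => S.
  have [[t St]|nS] := pselect (S !=set0); first by exists t.
  by exists t0 => /nS.
pose step x (rec : forall y, lt y x -> T) :=
  pick (D `\` [set t | exists y, exists p : lt y x, rec y p = t]).
pose i := Fix lt_wf (fun=> T) step.
have iE x : i x = pick (D `\` (i @` [set y | lt y x])).
  rewrite /i Fix_eq.
    by congr pick; congr (_ `\` _); apply/seteqP; split=> t [y];
      [case=> p <-; exists y|move=> p <-; exists y, p].
  move=> y f g fg; congr pick; congr (_ `\` _).
  by apply/seteqP; split=> t [z [p <-]]; exists z, p.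
have iP x : (D `\` (i @` [set y | lt y x])) (i x).
  by rewrite iE; apply: pickP; exact/fresh/countable_image/cnt_lt.
exists i => [x y ixy|x]; last by case: (iP x).
have [xy|[//|yx]] := lt_total x y; exfalso.
  by case: (iP y) => _; apply; exists x.
by case: (iP x) => _; apply; exists y.
Qed.

(** An uncountable [T] contains a copy of [I] and can therefore index the dominating family [h]. *)
Lemma card_lt_dd_countable {I : Type} {lt : I -> I -> Prop}
    (h : I -> nat -> nat) (T : Type) :
  omega1_order lt -> dominating (range h) -> card_lt_dd T ->
  countable [set: T].
Proof.
move=> lt_omega1 h_dom T_small; apply: contrapT => uncT.
have [i i_inj _] := omega1_embeds _ lt_omega1 uncT.
(* [r] transports [h] to [T] along [i], with the zero function off the range of [i]. *)
have [r rP] : {r : T -> nat -> nat & forall t x, i x = t -> r t = h x}.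
  apply: (@choice _ _ (fun t r => forall x, i x = t -> r = h x)) => t.
  have [[x <-]|nt] := pselect (exists x, i x = t).
    by exists (h x) => y /i_inj ->.
  by exists (fun=> 0%N) => x ix; exfalso; apply: nt; exists x.
apply: (T_small r) => f; have [_ [x _ <-] fh] := h_dom f.
by exists (h x) => //; exists (i x) => //; exact: rP.
Qed.

(** * Star properties of countable spaces *)

Lemma star_self {T : Type} (A : set T) (U : set (set T)) x :
  A x -> (\bigcup_(V in U) V) x -> star A U x.
Proof. by move=> Ax [V UV Vx]; exists V => //; split=> //; exists x. Qed.

Lemma countable_set_strongly_star_Lindelof (X : topologicalType) :
  countable [set: X] -> set_strongly_star_Lindelof X.
Proof.
move=> cntX A U _ _ AU; exists A; split.
- exact: sub_countable (subset_card_le (subsetT _)) cntX.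
- exact: subset_closure.
- by move=> x Ax; apply: star_self => //; apply/AU/subset_closure.
Qed.

Lemma countable_strongly_star_Lindelof (X : topologicalType) :
  countable [set: X] -> strongly_star_Lindelof X.
Proof.
move=> cntX U [_ coverU]; exists setT; split=> //; apply/seteqP; split=> // x _.
by apply: star_self; rewrite // coverU.
Qed.

Lemma countable_set_strongly_star_Menger (X : topologicalType) :
  countable [set: X] -> set_strongly_star_Menger X.
Proof.
move=> /countable_injP[f f_inj] A U _ _ AU.
(* Stage [n] takes care of the at most one point whose code under the injection [f] is [n]. *)
exists (fun n => A `&` [set x | f x = n]); split=> [n|n x [Ax _]|x Ax].
- apply: (@finite_set_bounded_inj _ f _ n) => [x y _ _|x [_ /= ->]//].
  exact: f_inj (in_setT _) (in_setT _).
- exact: subset_closure.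
- by exists (f x) => //; apply: star_self => //; apply/AU/subset_closure.
Qed.

Lemma countable_strongly_star_Menger (X : topologicalType) :
  countable [set: X] -> strongly_star_Menger X.
Proof.
move=> /countable_injP[f f_inj] U coverU.
exists (fun n => [set x | f x = n]); split=> [n|].
  apply: (@finite_set_bounded_inj _ f _ n) => [x y _ _|x /= ->//].
  exact: f_inj (in_setT _) (in_setT _).
apply/seteqP; split=> // x _; exists (f x) => //; apply: star_self => //.
by case: (coverU (f x)) => _ ->.
Qed.

(** * General facts on star selections and closed discrete sets *)

Lemma set_strongly_star_Menger_Lindelof (Y : topologicalType) :
  set_strongly_star_Menger Y -> set_strongly_star_Lindelof Y.
Proof.
move=> ssm A U A0 oU AU; have [//|//|F [finF FA AF]] := ssm A (fun=> U) A0.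
exists (\bigcup_n F n); split=> [|y [n _ /FA]//|y /AF[n _]].
  by apply: bigcup_countable => // n _; exact: finite_set_countable.
move=> [V [UV [z [Vz Fz]]] Vy]; exists V => //; split=> //.
by exists z; split=> //; exists n.
Qed.

(** Applied to the tail of [U] from [N] on, the Menger property covers each point at a stage beyond
    [N]. Stage [m] collects what the tails starting at [q <= m] select there, namely at their index
    [m - q]. *)
Lemma strongly_star_Menger_frequently (X : topologicalType) :
  strongly_star_Menger X -> forall U : nat -> set (set X),
  (forall n, open_cover (U n)) ->
  exists2 F : nat -> set X, forall n, finite_set (F n) &
    forall x N, exists2 n, (N <= n)%N & star (F n) (U n) x.
Proof.
move=> ssmX U coverU.
have /choice[F FP] q := ssmX (fun n => U (n + q)%N) (fun n => coverU _).
exists (fun m => \bigcup_(q in `I_m.+1) F q (m - q)%N) => [m|x N].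
  by apply: bigcup_finite => [|q _]; [exact: finite_II|case: (FP q)].
have [_ FN] := FP N.
have [n _ [V [UV [y [Vy Fy]]] Vx]] : (\bigcup_n star (F N n) (U (n + N)%N)) x.
  by rewrite FN.
exists (n + N)%N; first exact: leq_addl.
exists V => //; split=> //; exists y; split=> //.
by exists N; rewrite ?addnK//= ltnS leq_addl.
Qed.

Lemma closed_discrete_subset_closed {X : topologicalType} (A B : set X) :
  closed A -> discrete_subset A -> B `<=` A -> closed B.
Proof.
move=> clA discA BA x clBx.
have Ax : A x by apply: clA; exact: (closureS BA).
have [W oW WA] := discA x Ax.
have Wx : W x by have [] : (W `&` A) x by rewrite WA.
have [|y [By Wy]] := clBx W; first exact: open_nbhs_nbhs.
have : (W `&` A) y by split=> //; exact: BA.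
by rewrite WA => <-.
Qed.

Lemma closed_discrete_isolating_nbhs {X : topologicalType} (A : set X) :
  @regular_space X -> discrete_subset A -> forall a, A a ->
  exists G, [/\ open G, G a & forall b, A b -> closure G b -> b = a].
Proof.
move=> regX discA a Aa; have [W oW WA] := discA a Aa.
have Wa : W a by have [] : (W `&` A) a by rewrite WA.
have [|V Va VW] := regX a W; first exact: open_nbhs_nbhs.
exists V°; split; [exact: open_interior|exact: Va|move=> b Ab Vb].
have : (W `&` A) b by split=> //; exact/VW/(closureS (@interior_subset _ V)).
by rewrite WA.
Qed.

(** * Countable extent when omega_1 = d *)

Section ExtentBound.
Context {I : choiceType} {lt : I -> I -> Prop} {h : I -> nat -> nat}.
Context (lt_omega1 : omega1_order lt) (h_dom : dominating (range h)).

(* [e d] enumerates the predecessors of [d].  Truncating [e b] at [n] keeps the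
   union finite, yet each pair [d, g < b] contributes for almost all [n]. *)
Definition capture (e : I -> I -> nat) (n : nat) (b : I) : set I :=
  \bigcup_(d in [set d | lt d b /\ (e b d <= n)%N])
  \bigcup_(g in [set g | lt g b /\ (e b g <= n)%N])
    [set a | lt a d /\ (e d a <= h g n)%N].

Lemma finite_segment (e : I -> I -> nat) d k :
  {in [set y | lt y d] &, injective (e d)} ->
  finite_set [set a | lt a d /\ (e d a <= k)%N].
Proof.
move=> e_inj; apply: (@finite_set_bounded_inj _ (e d) _ k) => [x y|x []//].
by rewrite !inE => -[xd _] [yd _]; apply: e_inj; rewrite inE.
Qed.

Lemma finite_capture (e : I -> I -> nat) n b :
  (forall d, {in [set y | lt y d] &, injective (e d)}) ->
  finite_set (capture e n b).
Proof.
move=> e_inj; apply: bigcup_finite => [|d _]; first exact: finite_segment.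
by apply: bigcup_finite => [|g _]; exact: finite_segment.
Qed.

Lemma capture_lt (e : I -> I -> nat) n b a : capture e n b a -> lt a b.
Proof.
case: lt_omega1 => _ [lt_trans _] [d [db _] [g _ [ad _]]].
exact: lt_trans ad db.
Qed.

(** Some [d] lies above all the [S n], so [e d] codes their points and some [f n] bounds the codes
    in [S n]. Some [h g] dominates [f]. Take [b] above [d] and [g], and [N] past the domination
    threshold and the codes of [d] and [g] under [e b]. *)
Lemma capture_cofinal (e : I -> I -> nat) (S : nat -> set I) :
  (forall n, finite_set (S n)) ->
  exists b N, forall n, (N <= n)%N -> S n `<=` capture e n b.
Proof.
move=> finS.
have [|d Sd] := omega1_bounded (\bigcup_n S n) lt_omega1.
  by apply: bigcup_countable => // n _; exact: finite_set_countable.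
have /choice[f fP] n := finite_set_nat_bounded (e d) _ (finS n).
have [_ [g _ <-] [m fh]] := h_dom f.
have [|b bP] := omega1_bounded [set d; g] lt_omega1.
  exact: finite_set_countable.
exists b, (maxn m (maxn (e b d) (e b g))) => n.
rewrite !geq_max => /andP[mn /andP[dn gn]] a Sa.
exists d; first by split=> //; apply: bP; left.
exists g; first by split=> //; apply: bP; right.
split; first by apply: Sd; exists n.
exact: leq_trans (fP _ _ Sa) (fh _ mn).
Qed.

Lemma strongly_star_Menger_extent_countable (X : topologicalType) :
  @regular_space X -> strongly_star_Menger X -> extent_countable X.
Proof.
move=> regX ssmX D clD discD; apply: contrapT => uncD.
have [i i_inj iD] := omega1_embeds D lt_omega1 uncD.
have clA : closed (range i).
  by apply: closed_discrete_subset_closed clD discD _ => _ [b _ <-].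
have /choice[G GP] b :
    exists G, [/\ open G, G (i b) & forall a, closure G (i a) -> a = b].
  have [G [oG Gb Gsep]] := closed_discrete_isolating_nbhs D regX discD _ (iD b).
  by exists G; split=> // a Ga; apply: i_inj; exact: Gsep.
have /choice[e e_inj] d :
    exists f : I -> nat, {in [set y | lt y d] &, injective f}.
  by apply/countable_injP; case: lt_omega1 => _ [_ [_ [_ [_]]]].
pose V n b := G b `\` \bigcup_(a in capture e n b) closure (G a).
have oV n b : open (V n b).
  apply: openI; first by case: (GP b).
  apply: closed_openC; apply: closed_bigcup; first exact: finite_capture.
  by move=> a _; exact: closed_closure.
(* Captured indices lie strictly below [b], so none of the removed closures contains [i b]. *)
have Vi n b : V n b (i b).
  split; first by case: (GP b).
  move=> [a /capture_lt ab aib]; case: (GP a) => _ _ /(_ _ aib) ba.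
  by case: lt_omega1 => irr _; apply: (irr b); rewrite {1}ba.
(* The only member of [U n] that contains [i b] is [V n b]. *)
pose U n := range (V n) `|` [set ~` range i].
have coverU n : open_cover (U n).
  split=> [_ [[b _ <-]|->]//|]; first exact: closed_openC.
  apply/seteqP; split=> // x _; have [[b _ <-]|nx] := pselect (range i x).
    by exists (V n b) => //; left; exists b.
  by exists (~` range i) => //; right.
have [F finF Ffreq] := strongly_star_Menger_frequently _ ssmX U coverU.
have [b0 _] : exists b0 : I, True.
  apply: contrapT => I0; case: lt_omega1 => _ [_ [_ [_ [+ _]]]]; apply.
  rewrite (_ : setT = set0)//; apply/seteqP; split=> // b _.
  by apply: I0; exists b.
(* [t (n, y)] is an index whose shrunk neighbourhood at stage [n] contains [y], if there is one;
   [b0] is the default. *)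
have /choice[t tP] (ny : nat * X) :
    exists a, forall b, V ny.1 b ny.2 -> V ny.1 a ny.2.
  have [[a Va]|nV] := pselect (exists a, V ny.1 a ny.2); first by exists a.
  by exists b0 => b Vb; exfalso; apply: nV; exists b.
pose S n := (fun y => t (n, y)) @` F n.
have [|b [N SN]] := capture_cofinal e S; first by move=> n; exact: finite_image.
have [n Nn [W [UW [y [Wy Fy]]] Wb]] := Ffreq (i b) N.
case: UW => [[c _ cW]|WE]; last by move: Wb; rewrite WE; apply; exists b.
have bc : b = c.
  move: Wb; rewrite -cW => -[Gcb _]; case: (GP c) => _ _; apply.
  exact: subset_closure.
(* Now [y] is in [V n b], hence in [G (t (n, y))]; but [t (n, y)] is captured by [b] at stage [n],
   so [V n b] misses the closure of that set. *)
move: Wy; rewrite -cW -bc => Vby.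
have [Gty _] := tP (n, y) _ Vby.
case: Vby => _; apply; exists (t (n, y)); last exact: subset_closure.
by apply: (SN n Nn); exists y.
Qed.

End ExtentBound.

(** * Constructions of orders of type omega_1 *)

Lemma uncountable_omega1_order (T : choiceType) : ~ countable [set: T] ->
  exists (J : set T) (lt : J -> J -> Prop), omega1_order lt.
Proof.
move=> uncT; have [R wo] := well_ordering_principle T.
have minP (A : set T) : A !=set0 ->
    exists m, [/\ A m, forall x, A x -> R m x &
      forall m', A m' -> (forall x, A x -> R m' x) -> m = m'].
  move=> [a Aa]; have [|m [[mA mle] mU]] := wo (mem A).
    by exists a; rewrite inE.
  exists m; split=> [|x Ax|m' Am' m'le]; first by rewrite inE in mA.
    by apply: mle; rewrite inE.
  by apply: mU; split=> [|x]; rewrite inE//; exact: m'le.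
(* The order axioms for [R] follow from unique least elements of sets with at most three points. *)
have refl x : R x x by have [|m [-> + _]] := minP [set x]; [exists x|apply].
have total x y : R x y \/ R y x.
  have [|m [[->|->] le_m _]] := minP [set x; y]; first by exists x; left.
    by left; apply: le_m; right.
  by right; apply: le_m; left.
have anti x y : R x y -> R y x -> x = y.
  move=> xy yx; have [|m [_ _ mU]] := minP [set x; y]; first by exists x; left.
  by rewrite -(mU x) ?(mU y) //; do ?[by left|by right]; move=> z [->|->].
have trans x y z : R x y -> R y z -> R x z.
  move=> xy yz.
  have [|m [Am le_m _]] := minP [set t | [\/ t = x, t = y | t = z]].
    by exists x; constructor 1.
  case: Am le_m => -> le_m.
  - by apply: le_m; constructor 3.
  - by rewrite (anti x y)//; apply: le_m; constructor 1.
  - by rewrite -(anti y z)//; apply: le_m; constructor 2.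
pose below (x : T) := [set y | R y x /\ y <> x].
(* The points with countably many predecessors form a copy of omega_1. *)
pose J : set T := [set x | countable (below x)].
exists J, (fun x y => below (val y) (val x)).
have wf : well_founded (fun x y : T => below y x).
  move=> x; apply: contrapT => nAx.
  have [|m [nAm le_m _]] := minP [set x | ~ Acc (fun x y => below y x) x].
    by exists x.
  apply: nAm; constructor => y [ym neq]; apply: contrapT => nAy.
  by apply: neq; apply: anti => //; exact: le_m.
(* The least point outside [J] has all its predecessors in [J]; were [J] countable, that point would
   belong to [J]. *)
have uncJ : ~ countable J.
  move=> cntJ.
  have [p [nJp le_p _]] : exists m, [/\ (~` J) m, forall x, (~` J) x -> R m x &
      forall m', (~` J) m' -> (forall x, (~` J) x -> R m' x) -> m = m'].
    apply: minP; apply: contrapT => /set0P/negP/negPn/eqP nJ; apply: uncT.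
    by rewrite -(setCK J) nJ setC0 in cntJ.
  apply: nJp; apply: sub_countable (subset_card_le _) cntJ => y [yp neq].
  by apply: contrapT => nJy; apply: neq; apply: anti => //; exact: le_p.
split; first by move=> x [].
split.
  move=> x y z [xy neq] [yz neq']; split; first exact: trans xy yz.
  by move=> xz; apply: neq'; apply: anti => //; rewrite -xz.
split.
  move=> x y; have [->|neq] := eqVneq x y; first by right; left.
  have /eqP vneq : val x != val y by rewrite (inj_eq val_inj).
  by have [xy|yx] := total (val x) (val y); [left|right; right];
    split=> //; apply: nesym.
split.
  move=> x; have [v xv] : exists v, val x = v by exists (val x).
  move: x xv; elim: v / (wf v) => v _ IH x xv; constructor => y yx.
  by apply: (IH (val y)) => //; rewrite -xv.
split; first by rewrite (eq_countable (card_setT _)).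
move=> x; apply: (countable_inj_image (val : J -> T) _ val_inj).
have Jx : J (val x) := set_valP x.
by apply: sub_countable (subset_card_le _) Jx => _ [y yx <-].
Qed.

(** The countable [C], ordered by its codes, is put in front of [I]. This will order the nodes and
    branches of the Mrowka space in type omega_1. *)
Definition sum_lt {C : countType} {I : Type} (lt : I -> I -> Prop)
    (x y : C + I) : Prop :=
  match x, y with
  | inl a, inl b => (choice.pickle a < choice.pickle b)%N
  | inl _, inr _ => True
  | inr _, inl _ => False
  | inr i, inr j => lt i j
  end.

Lemma sum_lt_omega1 {C : countType} {I : Type} (lt : I -> I -> Prop) :
  omega1_order lt -> omega1_order (@sum_lt C I lt).
Proof.
move=> [irr [tr [tot [wf [unc cnt]]]]].
have inr_inj : injective (@inr C I) by move=> x y [].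
split; first by case=> [a|i] /=; [rewrite ltnn|exact: irr].
split; first by move=> [a|i] [b|j] [c|k] //=; [exact: ltn_trans|exact: tr].
split.
  move=> [a|i] [b|j] /=; [|by left|by right; right|].
    have [ab|ba|/(pcan_inj choice.pickleK) ->] :=
        ltngtP (choice.pickle a) (choice.pickle b).
    - by left.
    - by right; right.
    - by right; left.
  by have [ij|[->|ji]] := tot i j; [left|right; left|right; right].
have accl (a : C) : Acc (@sum_lt C I lt) (inl a).
  have [n an] : exists n, (choice.pickle a < n)%N.
    by exists (choice.pickle a).+1.
  elim: n a an => [a|n IH a]; first by rewrite ltn0.
  rewrite ltnS => an; constructor => -[b /= ba|i []].
  by apply: IH; exact: leq_trans ba an.
split.
  move=> [//|i]; elim: i / (wf i) => i _ IH.
  by constructor => -[a _ //|j ji]; exact: IH.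
split.
  move=> cntS; apply: unc; apply: (countable_inj_image _ _ inr_inj).
  exact: sub_countable (subset_card_le (subsetT _)) cntS.
move=> x.
pose A : set (C + I) := \bigcup_(y in @setT C) [set inl y].
pose B : set (C + I) :=
  if x is inr i then inr @` [set y | lt y i] else set0.
apply: (@sub_countable _ _ _ (A `|` B)); last first.
  rewrite -bigcup2E; apply: bigcup_countable => // -[|[|n]] _ //=.
    by apply: bigcup_countable.
  by rewrite /B; case: {B} x => // i; exact/countable_image/cnt.
apply: subset_card_le => -[a _|j]; first by left; exists a.
by rewrite /B; case: {B} x => //= i ji; right; exists j.
Qed.

(* The Mrowka space of the almost disjoint family of branches [x] in [J] of the
   binary tree: nodes are isolated and the neighbourhoods of a branch contain
   all but finitely many of its initial segments. *)
Definition branch_space (J : set (nat -> bool)) : Type := (seq bool + J)%type.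

(** * The topology of the Mrowka space *)

Section BranchSpace.
Context (J : set (nat -> bool)).
Local Notation X := (branch_space J).
Implicit Types (x y : J) (s : seq bool) (n m : nat).

HB.instance Definition _ := Choice.copy X (seq bool + J)%type.

Definition node s : X := inl s.
Definition branch x : X := inr x.
Definition initial x n : X := node (mkseq (val x) n).

Definition branch_open : set_system X := [set U | forall x, U (branch x) ->
  exists n, forall m, (n <= m)%N -> U (initial x m)].

Lemma branch_openT : branch_open setT.
Proof. by move=> x _; exists 0%N. Qed.

Lemma branch_openI : setI_closed branch_open.
Proof.
move=> A B oA oB x [/oA[n An] /oB[m Bm]]; exists (maxn n m) => k.
by rewrite geq_max => /andP[nk mk]; split; [exact: An|exact: Bm].
Qed.

Lemma branch_open_bigU (I : Type) (f : I -> set X) :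
  (forall i, branch_open (f i)) -> branch_open (\bigcup_i f i).
Proof.
by move=> of_ x [i _ /of_[n fn]]; exists n => m nm; exists i => //; exact: fn.
Qed.

HB.instance Definition _ :=
  isOpenTopological.Build X branch_openT branch_openI branch_open_bigU.

Lemma branch_openP (U : set X) : open U <-> branch_open U.
Proof. by []. Qed.

(** Almost disjointness: an initial segment longer than a coordinate where [x] and [y] differ
    records that coordinate. *)
Lemma initial_neq x y : x <> y ->
  exists n, forall m k, (n <= m)%N -> initial x m <> initial y k.
Proof.
move=> neq; have [n xyn] : exists n, val x n <> val y n.
  apply: contrapT => nxy; apply: neq; apply/val_inj/funext => n.
  by apply: contrapT => xyn; apply: nxy; exists n.
exists n.+1 => m k nm [/[dup]/(congr1 size)]; rewrite !size_mkseq => <- eqm.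
by apply: xyn; have /(congr1 (nth false ^~ n)) := eqm; rewrite !nth_mkseq.
Qed.

Definition tail_nbhs x n : set X :=
  branch x |` [set initial x m | m in [set m | (n <= m)%N]].

Lemma open_tail_nbhs x n : open (tail_nbhs x n).
Proof.
apply/branch_openP => y [[->]|[m _ []//]].
by exists n => m nm; right; exists m.
Qed.

Lemma closed_tail_nbhs x n : closed (tail_nbhs x n).
Proof.
rewrite -openC; apply/branch_openP => y nxy.
have neq : y <> x by move=> yx; apply: nxy; left; rewrite yx.
have [k kP] := initial_neq _ _ neq; exists k => m km.
by move=> [//|[l _ /esym/(kP _ _ km)]].
Qed.

Lemma open_node s : open [set node s].
Proof. by apply/branch_openP => x. Qed.

Lemma closed_node s : closed [set node s].
Proof.
(* A branch can pass through [s] only at length [size s]. *)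
rewrite -openC; apply/branch_openP => x _; exists (size s).+1 => m sm [ms].
by move: sm; rewrite -ms size_mkseq ltnn.
Qed.

(** Zero-dimensionality, from which regularity follows because a clopen neighbourhood is its own
    closure. *)
Lemma clopen_base (p : X) (U : set X) : open U -> U p ->
  exists V, [/\ open V, closed V, V p & V `<=` U].
Proof.
case: p => [s|x] oU Up.
  exists [set node s]; split=> [|||_ ->//]; last by [].
    exact: open_node.
  exact: closed_node.
have [n nP] := oU x Up; exists (tail_nbhs x n).
split; [exact: open_tail_nbhs|exact: closed_tail_nbhs|by left|].
by move=> _ [->//|[m nm <-]]; exact: nP.
Qed.

Lemma branch_space_regular : regular X.
Proof.
split; last first.
  move=> p A pA.
  have [U [oU Up] UA] : exists2 U, open_nbhs p U & U `<=` A.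
    by move: pA; rewrite nbhsE.
  have [V [oV clV Vp VU]] := clopen_base p U oU Up.
  exists V; first exact: open_nbhs_nbhs.
  by move/closure_id : clV => <-; exact: subset_trans UA.
move=> p q /eqP pq.
suff clq : closed [set q].
  exists (~` [set q]); split; first exact: closed_openC.
    by rewrite inE.
  by rewrite inE => /(_ erefl).
case: q {pq} => [s|x]; first exact: closed_node.
rewrite -openC; apply/branch_openP => y yx; exists 0%N => m _ //.
Qed.

Lemma closed_branches : closed (range branch).
Proof.
rewrite -openC; apply/branch_openP => x nx; exfalso; apply: nx.
by exists x.
Qed.

Lemma discrete_branches : discrete_subset (range branch).
Proof.
move=> _ [x _ <-]; exists (tail_nbhs x 0%N); first exact: open_tail_nbhs.
apply/seteqP; split=> [_ [[->//|[m _ <-]] [y _ //]]|_ ->].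
by split; [left|exists x].
Qed.

Lemma uncountable_branches :
  ~ countable [set: J] -> ~ countable (range branch).
Proof. by move=> uncJ /countable_inj_image cJ; apply/uncJ/cJ => x y []. Qed.

(** * Star properties of the Mrowka space and of its set of branches *)

Lemma branch_space_strongly_star_Lindelof : strongly_star_Lindelof X.
Proof.
move=> U [oU coverU]; exists (range node); split.
  exact: countable_image.
apply/seteqP; split=> // p _.
have [V UV Vp] : (\bigcup_(V in U) V) p by rewrite coverU.
exists V => //; split=> //; case: p Vp => [s|x] Vp.
  by exists (node s); split=> //; exists s.
(* The countable set of nodes is dense: an open set around a branch contains its late initial
   segments. *)
have [n nP] := oU V UV x Vp; exists (initial x n); split; first exact: nP.
by exists (mkseq (val x) n).
Qed.

(** Let [f p n] code a node whose star in [U n] contains [p]. The space being smaller than d, the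
    functions [f p] do not dominate some [g], and the nodes with code at most [g n] form the finite
    set of stage [n]. *)
Lemma branch_space_strongly_star_Menger :
  card_lt_dd X -> strongly_star_Menger X.
Proof.
move=> smallX U coverU.
have /choice[f fP] (p : X) : exists f : nat -> nat, forall n, exists s,
    choice.pickle s = f n /\ star [set node s] (U n) p.
  suff /choice[f fP] n : exists k, exists s,
    choice.pickle s = k /\ star [set node s] (U n) p by exists f.
  suff [s sP] : exists s, star [set node s] (U n) p.
    by exists (choice.pickle s), s.
  have [oU cU] := coverU n.
  have [V UV Vp] : (\bigcup_(V in U n) V) p by rewrite cU.
  case: p Vp => [s|x] Vp.
    by exists s, V => //; split=> //; exists (node s).
  have [m mP] := oU V UV x Vp; exists (mkseq (val x) m), V => //.
  by split=> //; exists (initial x m); split=> //; exact: mP.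
have [g gP] : exists g, forall p, ~ le_star g (f p).
  apply: contrapT => nog; apply: (smallX f) => g; apply: contrapT => ng.
  by apply: nog; exists g => p gf; apply: ng; exists (f p) => //; exists p.
exists (fun n => node @` [set s | (choice.pickle s <= g n)%N]); split=> [n|].
  apply: finite_image.
  apply: (@finite_set_bounded_inj _ choice.pickle _ (g n)) => //.
  by move=> s t _ _ /(pcan_inj choice.pickleK).
apply/seteqP; split=> // p _.
have [n fg] : exists n, (f p n <= g n)%N.
  apply: contrapT => nfg; apply: (gP p); exists 0%N => n _.
  by rewrite leqNgt; apply/negP => /ltnW ?; apply: nfg; exists n.
exists n => //; have [s [sf [V [UV [q [Vq qs]]] Vp]]] := fP p n.
exists V => //; split=> //; exists q; split=> //.
by exists s; rewrite //= sf.
Qed.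

(** Each [tail_nbhs x 0] contains a single branch, so the star of a set [F] of branches contains no
    branch outside [F]. *)
Lemma branch_space_not_set_strongly_star_Lindelof :
  ~ countable [set: J] -> ~ set_strongly_star_Lindelof X.
Proof.
move=> uncJ ssl; apply: (uncountable_branches uncJ).
have [x _] : exists x : J, True.
  apply: contrapT => J0; apply: uncJ.
  rewrite (_ : setT = set0)//; apply/seteqP; split=> // x _.
  by apply: J0; exists x.
have clB := (closure_id _).1 closed_branches.
have [|||F [cntF FB BF]] :=
    ssl (range branch) [set tail_nbhs x 0%N | x in [set: J]].
- by exists (branch x), x.
- by move=> _ [y _ <-]; exact: open_tail_nbhs.
- rewrite -clB => _ [y _ <-]; exists (tail_nbhs y 0%N); last by left.
  by exists y.
apply: sub_countable (subset_card_le _) cntF => p Bp.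
have [_ [[y _ <-] [q [yq Fq]]] yp] := BF p Bp.
have tailB r : tail_nbhs y 0%N r -> range branch r -> r = branch y.
  by move=> [//|[m _ <-] [z _ //]].
by rewrite (tailB p)// -(tailB q)// clB; exact: FB.
Qed.

(** The subspace is discrete; for the cover by singletons, the star of [F n] is [F n], and countably
    many finite sets cannot exhaust it. *)
Lemma branches_not_strongly_star_Menger :
  ~ countable [set: J] -> ~ strongly_star_Menger (set_type (range branch)).
Proof.
move=> uncJ ssm; pose B := set_type (range branch).
have [|F [finF FB]] := ssm (fun=> [set [set b] | b in [set: B]]).
  split=> [_ [b _ <-]|]; last first.
    by apply/seteqP; split=> // b _; exists [set b] => //; exists b.
  have [x _ xb] := set_valP b.
  exists (tail_nbhs x 0%N); first exact: open_tail_nbhs.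
  apply/seteqP; split=> [c /= [cx|[m _ mc]]|_ ->] /=.
  - by apply: val_inj; rewrite /= -xb -cx.
  - by have [y _ yc] := set_valP c; have := etrans yc (esym mc).
  - by left; exact: esym xb.
suff : countable [set: B].
  by rewrite (eq_countable (card_setT _)); exact: uncountable_branches.
rewrite -FB; apply: bigcup_countable => // n _.
apply: (@sub_countable _ _ _ (F n)); last exact: finite_set_countable.
by apply: subset_card_le => b [_ [[c _ <-] [d [-> Fd]]] ->].
Qed.

End BranchSpace.

(** * The equivalences *)

Lemma omega1_lt_dd_branch_space : ~ omega1_eq_dd ->
  exists J, ~ countable [set: set_type J] /\ card_lt_dd (branch_space J).
Proof.
move=> nP1.
have [J [lt lt_omega1]] := uncountable_omega1_order _ uncountable_cantor.
exists J; split; first by case: lt_omega1 => _ [_ [_ [_ []]]].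
(* The space has size omega_1, so a dominating family indexed by it would yield omega_1 = d. *)
move=> h h_dom; apply: nP1; split; first exact: countable_not_dominating.
exists (branch_space J), (@sum_lt (seq bool) J lt); split; last by exists h.
exact: sum_lt_omega1.
Qed.

Theorem theorem2p5 :
  let P1 := omega1_eq_dd in
  let P2 := forall X : topologicalType,
      regular X -> strongly_star_Menger X -> extent_countable X in
  let P3 := forall X : topologicalType, regular X -> card_lt_dd X ->
      (set_strongly_star_Menger X <-> strongly_star_Menger X) in
  let P4 := forall X : topologicalType, regular X -> card_lt_dd X ->
      (set_strongly_star_Lindelof X <-> strongly_star_Lindelof X) in
  let P5 := forall X : topologicalType, regular X -> card_lt_dd X ->
      strongly_star_Menger X ->
      forall C : set X, closed C -> strongly_star_Menger (set_type C) in
  [/\ P1 <-> P2, P1 <-> P3, P1 <-> P4 & P1 <-> P5].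
Proof.
move=> P1 P2 P3 P4 P5.
have small_countable (X : topologicalType) :
    P1 -> card_lt_dd X -> countable [set: X].
  move=> [_ [I [lt [lt_omega1 [h h_dom]]]]].
  exact: (card_lt_dd_countable h X lt_omega1 h_dom).
split; split=> [p1|p].
- move=> X [_ regX] ssmX; case: p1 => _ [I [lt [lt_omega1 [h h_dom]]]].
  (* The axiom of choice gives the index type the choice structure over which the extent bound is
     stated. *)
  elim/Pchoice: I => I in lt lt_omega1 h h_dom *.
  exact: (@strongly_star_Menger_extent_countable I lt h).
(* This converse and the next three are by contraposition: if omega_1 differs from d, the Mrowka
   space of [J] is a counterexample. *)
- apply: contrapT => /omega1_lt_dd_branch_space[J [uncJ smallX]].
  apply: (uncountable_branches J uncJ).
  apply: p (closed_branches J) (discrete_branches J).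
    exact: branch_space_regular.
  exact: branch_space_strongly_star_Menger.
- move=> X _ /(small_countable X p1) cntX; split=> _.
    exact: countable_strongly_star_Menger.
  exact: countable_set_strongly_star_Menger.
- apply: contrapT => /omega1_lt_dd_branch_space[J [uncJ smallX]].
  apply: (branch_space_not_set_strongly_star_Lindelof J uncJ).
  apply: set_strongly_star_Menger_Lindelof.
  apply/(p _ (branch_space_regular J) smallX).
  exact: branch_space_strongly_star_Menger.
- move=> X _ /(small_countable X p1) cntX; split=> _.
    exact: countable_strongly_star_Lindelof.
  exact: countable_set_strongly_star_Lindelof.
- apply: contrapT => /omega1_lt_dd_branch_space[J [uncJ smallX]].
  apply: (branch_space_not_set_strongly_star_Lindelof J uncJ).
  apply/(p _ (branch_space_regular J) smallX).
  exact: branch_space_strongly_star_Lindelof.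
- move=> X _ /(small_countable X p1) cntX _ C _.
  apply: countable_strongly_star_Menger; rewrite (eq_countable (card_setT _)).
  exact: sub_countable (subset_card_le (subsetT _)) cntX.
- apply: contrapT => /omega1_lt_dd_branch_space[J [uncJ smallX]].
  apply: (branches_not_strongly_star_Menger J uncJ).
  have ssmX := branch_space_strongly_star_Menger J smallX.
  exact: (p _ (branch_space_regular J) smallX ssmX _ (closed_branches J)).
Qed.
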